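(* Let $\mu,\nu$ be two Borel probability measures on $\mathrm{A}$ and let $\alpha\in(0,1)$ be the change point of a conceptual sequence on the time interval $(0,1)$, the probability measures before and after $\alpha$ being $\mu$ and $\nu$ respectively. For a time $\beta\in(0,1)$ let $$h_\alpha(\beta)=\frac{\alpha}{\beta}I(\beta\ge\alpha)+\frac{1-\alpha}{1-\beta}I(\beta<\alpha).$$ If $\beta>\alpha$, the probability measures before and after $\beta$ are $\frac{\alpha}{\beta}\mu+(1-\frac{\alpha}{\beta})\nu$ and $\nu$, and $$D_\beta\Big(\frac{\alpha}{\beta}\mu+\Big(1-\frac{\alpha}{\beta}\Big)\nu,\ \nu\Big)=\Big(\frac{\alpha}{\beta}\Big)^2D_\alpha(\mu,\nu).$$ In general, for $\beta\in(0,1)$, $$D_\beta\big(h_\alpha(\beta)\mu+(1-h_\alpha(\beta))\nu,\ \nu\big)=h_\alpha^2(\beta)\,D_\alpha(\mu,\nu),$$ and the maximum of $h_\alpha(\beta)$ is attained when $\beta=\alpha$. Consequently the Ball detection function $$V(\beta;\mu,\nu)=\beta(1-\beta)\,D_\beta\big(h_\alpha(\beta)\mu+(1-h_\alpha(\beta))\nu,\ \nu\big)$$ satisfies $$V(\beta;\mu,\nu)=\beta(1-\beta)\,h_\alpha^2(\beta)\,D_\alpha(\mu,\nu).$$ The maximum of $\beta(1-\beta)h_\alpha(\beta)$ is also attained when $\beta=\alpha$, and $V(\beta;\mu,\nu)$ reaches its maximum at the change point $\beta=\alpha$, so that the change point can be found by maximizing $V(\beta;\mu,\nu)$ over $\b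eta$.
   Context: $(\mathrm{A},\|\cdot\|)$ is a separable Banach space, $\rho(u,v)=\|u-v\|$, and $\bar B(u,r)=\{x:\rho(x,u)\le r\}$ is the closed ball. For Borel probability measures $\mu,\nu$ on $\mathrm{A}$ and $\alpha\in[0,1]$, the Ball divergence with scale parameter $\alpha$ is $$D_\alpha(\mu,\nu)=\iint_{\mathrm{A}\times\mathrm{A}}\big[\mu(\bar B(u,\rho(u,v)))-\nu(\bar B(u,\rho(u,v)))\big]^2\,\omega_\alpha(du)\,\omega_\alpha(dv),\qquad \omega_\alpha=\alpha\mu+(1-\alpha)\nu.$$ $I(\cdot)$ is the indicator function.
   Formalization: For β<α the displayed identity and V are false with the pair (hμ+(1−h)ν, ν); they are stated with the actual laws before and after β, (μ, hν+(1−h)μ). That maximizing V finds the change point is stated under D_α(μ,ν)≠0, since otherwise V is identically 0. *)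

(* Defs.v *)
From HB Require Import structures.
From mathcomp Require Import all_boot all_order all_algebra.
From mathcomp Require Import all_classical all_reals all_analysis.
Set Implicit Arguments.
Unset Strict Implicit.
Unset Printing Implicit Defensive.
Import Order.TTheory GRing.Theory Num.Theory.
Import numFieldNormedType.Exports.
Local Open Scope classical_set_scope.
Local Open Scope ring_scope.

(* The points of A, measured by the Borel sigma-algebra of the norm topology. *)
Notation borelType A := (g_sigma_algebraType (@open A)).

Section mixture.
Context {d} {T : measurableType d} {R : realType}.

(* t m + (1 - t) n. For t outside [0, 1] this need not be a measure, so, as in *)
(* bernoulli_prob, a junk probability is returned there.                       *)
Definition mix (t : R) (m n : probability T R) (S : set T) : \bar R :=
  if 0 <= t <= 1 then (t%:E * m S + (1 - t)%:E * n S)%E else n S.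

Variables (t : R) (m n : probability T R).

Let mix0 : mix t m n set0 = 0%E.
Proof. by rewrite /mix !measure0; case: ifP => // _; rewrite !mule0 adde0. Qed.

Let mix_ge0 S : (0 <= mix t m n S)%E.
Proof.
rewrite /mix; case: ifPn => [/andP[t0 t1]|_] //.
by apply: adde_ge0; apply: mule_ge0; rewrite ?lee_fin ?subr_ge0.
Qed.

Let mix_sigma_additive : semi_sigma_additive (mix t m n).
Proof.
have [/andP[t0 t1]|t01] := boolP (0 <= t <= 1); last first.
  rewrite (_ : mix t m n = n); first exact: measure_semi_sigma_additive.
  by apply/funext => S; rewrite /mix (negbTE t01).
have t1' : 0 <= 1 - t by rewrite subr_ge0.
rewrite (_ : mix t m n =
    measure_add (mscale (NngNum t0) m) (mscale (NngNum t1') n)); last first.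
  by apply/funext => S; rewrite /mix t0 t1 measure_addE.
exact: measure_semi_sigma_additive.
Qed.

HB.instance Definition _ := isMeasure.Build _ _ _ (mix t m n)
  mix0 mix_ge0 mix_sigma_additive.

Let mix_setT : mix t m n [set: T] = 1%E.
Proof.
by rewrite /mix !probability_setT; case: ifP => // _; rewrite !mule1 -EFinD addrC subrK.
Qed.

HB.instance Definition _ :=
  @Measure_isProbability.Build _ _ R (mix t m n) mix_setT.

End mixture.

Section ball_divergence.
Context {R : realType} {A : completeNormedModType R}.
Implicit Types m n : probability (borelType A) R.

(* The closed ball of center u through v. The library's closed_ball is the     *)
(* closure of an open ball, which is empty (instead of [set u]) when u = v.    *)
Definition ball_through (u v : A) : set (borelType A) :=
  closed_ball_ (fun x : A => `|x|) u `|u - v|.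

Definition ball_div (a : R) m n : R :=
  \int[(mix a m n \x mix a m n)%E]_z
    (fine (m (ball_through z.1 z.2)) - fine (n (ball_through z.1 z.2))) ^+ 2.

End ball_divergence.

(* The indicators are the booleans (a <= b) and (b < a), coerced to R. *)
Definition hfun {R : realType} (a b : R) : R :=
  a / b * (a <= b)%R%:R + (1 - a) / (1 - b) * (b < a)%R%:R.

Section change_point.
Context {d} {T : measurableType d} {R : realType}.
Implicit Types (a b t : R) (m n : probability T R).

(* The sequence indexed by ]0, 1[: law m until the change point a, then n. *)
Definition law_at a m n t : probability T R := if t < a then m else n.

(* Laws of the part of the sequence before b, and of the part after b: the     *)
(* averages of law_at over ]0, b[ and over ]b, 1[.                             *)
Definition average_before a b m n (S : set T) : \bar R :=
  ((b^-1)%:E * \int[lebesgue_measure]_(t in `]0%R, b[) law_at a m n t S)%E.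
Definition average_after a b m n (S : set T) : \bar R :=
  (((1 - b)^-1)%:E * \int[lebesgue_measure]_(t in `]b, 1%R[) law_at a m n t S)%E.

(* The same laws in closed form. If a <= b the pair is (h m + (1 - h) n, n);   *)
(* if b < a the part before b is pure and the mixture is on the other side,    *)
(* which gives (m, h n + (1 - h) m). Here h = hfun a b.                        *)
Definition before a b m n : probability T R :=
  if a <= b then (mix (hfun a b) m n : probability T R) else m.
Definition after a b m n : probability T R :=
  if a <= b then n else (mix (hfun a b) n m : probability T R).

End change_point.

(* The Ball detection function V(b; m, n) for the change point a. *)
Definition detection {R : realType} {A : completeNormedModType R}
    (a : R) (m n : probability (borelType A) R) (b : R) : R :=
  b * (1 - b) * ball_div b (before a b m n) (after a b m n).

(* Main.v *)
(* With h = hfun a b, the pair of laws on either side of b has the same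
   b-weighted mixture as (m, n) has a-weighted, and the difference of the two
   laws on a ball is h times m - n. Hence the integral defining ball_div is
   merely scaled by h^2. The case b < a is the case a < b after the exchange
   a -> 1 - a, m <-> n. The weight b (1 - b) h^2 is bounded by b (1 - b) h,
   which is a (1 - b) after a and b (1 - a) before a, and peaks at b = a. *)
Require Import Defs.
From HB Require Import structures.
From mathcomp Require Import all_boot all_order all_algebra.
From mathcomp Require Import all_classical all_reals all_analysis.
From mathcomp Require Import measurable_realfun ring lra.
Set Implicit Arguments.
Unset Strict Implicit.
Unset Printing Implicit Defensive.
Import Order.TTheory GRing.Theory Num.Theory.
Import numFieldNormedType.Exports.
Local Open Scope classical_set_scope.
Local Open Scope ring_scope.

(** * Integrals over open intervals of constants and of functions with one jump *)

Section step_integral.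
Context {R : realType}.
Implicit Types (x y a : R) (c d : \bar R).

Lemma integral_itvoo_cst x y c : x <= y ->
  (\int[lebesgue_measure]_(t in `]x, y[) c = (y - x)%:E * c)%E.
Proof.
move=> xy; rewrite integral_cst//= lebesgue_measure_itv/= lte_fin muleC.
have [_|yx] := ltP x y; first by rewrite EFinD.
by rewrite (@le_anti _ _ x y) ?xy// subrr.
Qed.

Lemma integral_itvoo_step x y a c d : x <= a -> a <= y ->
    (0 <= c)%E -> (0 <= d)%E ->
  (\int[lebesgue_measure]_(t in `]x, y[) (if (t < a)%R then c else d) =
   (a - x)%:E * c + (y - a)%:E * d)%E.
Proof.
move=> xa ay c0 d0.
have mf D : measurable_fun D (fun t : R => if t < a then c else d).
  apply: measurable_funTS; apply: measurable_fun_ifT => //.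
  by apply: measurable_fun_ltr.
(* Closing the left end costs only a null set and lets the interval split at [a] into two half-open
   pieces even when [x = a]. *)
rewrite integral_itv_obnd_cbnd//.
rewrite (@itv_bndbnd_setU _ _ _ (BLeft a)) ?bnd_simp//.
rewrite ge0_integral_setU//; last first.
- apply/disj_setPS => t [/=]; rewrite !in_itv/= => /andP[_ ta] /andP[at_ _].
  by move: ta; rewrite ltNge at_.
- by move=> t _; case: ifP.
- exact: mf.
congr (_ + _)%E.
- rewrite -integral_itv_obnd_cbnd// -integral_itvoo_cst//.
  apply: eq_integral => t; rewrite inE/= in_itv/= => /andP[_ ta].
  by rewrite ta.
- rewrite -integral_itv_obnd_cbnd// -integral_itvoo_cst//.
  apply: eq_integral => t; rewrite inE/= in_itv/= => /andP[at_ _].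
  by rewrite ltNge (ltW at_).
Qed.

End step_integral.

(** * Positive scaling of integrals of nonnegative functions *)

Section nonnegative_scaling.
Import HBNNSimple.
Context d (T : measurableType d) (R : realType).
Variable mu : {measure set T -> \bar R}.

(* The function is not assumed measurable: scaling is a bijection between the
   simple functions below f and those below c f. *)
Lemma ge0_RintegralZl_gt0 (c : R) (f : T -> R) :
  0 < c -> (forall x, 0 <= f x) ->
  \int[mu]_x (c * f x) = c * \int[mu]_x f x.
Proof.
move=> c0 f0.
have scale_le (k : R) (g : T -> R) : 0 < k -> (forall x, 0 <= g x) ->
    (k%:E * \int[mu]_x (g x)%:E <= \int[mu]_x (k * g x)%:E)%E.
  move=> k0 g0.
  have kg0 x : (0 <= (k * g x)%:E)%E by rewrite lee_fin mulr_ge0// ltW.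
  rewrite !ge0_integralTE// -ereal_sup_pZl//.
  apply: ereal_sup_le => _ [_ [h /= hg <-] <-].
  exists (scale_nnsfun h (ltW k0)) => [x|]; last exact: sintegralrM.
  by rewrite /= EFinM [leRHS]EFinM lee_pmul2l ?lte_fin.
suff cE : (\int[mu]_x (c * f x)%:E = c%:E * \int[mu]_x (f x)%:E)%E.
  rewrite /Rintegral cE.
  (* [fine] sends infinite values to 0, so both sides vanish when the integral is infinite. *)
  case: (\int[mu]_x (f x)%:E)%E => [r//| |].
    by rewrite gt0_muley ?lte_fin// mulr0.
  by rewrite gt0_muleNy ?lte_fin// mulr0.
apply/eqP; rewrite eq_le scale_le// andbT.
(* The reverse inequality is [scale_le] again, for the factor [c^-1] and the function [c * f]. *)
rewrite -lee_pdivrMl//.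
have cf0 x : 0 <= c * f x by rewrite mulr_ge0// ltW.
apply: le_trans (scale_le c^-1 _ _ cf0) _; first by rewrite invr_gt0.
by under eq_integral do rewrite mulKf ?gt_eqF//.
Qed.

End nonnegative_scaling.

(** * Algebra of mixtures of two laws *)

Section mixtures.
Context {d} {T : measurableType d} {R : realType}.
Implicit Types (s t : R) (m n : probability T R) (S : set T).

Lemma mixE t m n S : 0 <= t <= 1 ->
  mix t m n S = (t%:E * m S + (1 - t)%:E * n S)%E.
Proof. by rewrite /mix => ->. Qed.

Lemma mixC t m n : 0 <= t <= 1 -> mix t m n = mix (1 - t) n m.
Proof.
move=> /[dup] t01 /andP[t0 t1]; apply/funext => S.
by rewrite !mixE ?subr_ge0 ?gerBl ?t0 ?t1// subKr addeC.
Qed.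

(** The weights of [n] add up: [t * (1 - s) + (1 - t) = 1 - t * s]. *)
Lemma mix_mixl s t m n : 0 <= s <= 1 -> 0 <= t <= 1 ->
  mix t (mix s m n) n = mix (t * s) m n.
Proof.
move=> /[dup] s01 /andP[s0 s1] /[dup] t01 /andP[t0 t1]; apply/funext => S.
have ts01 : 0 <= t * s <= 1 by rewrite mulr_ge0 ?mulr_ile1.
rewrite mixE//= !mixE//.
rewrite ge0_muleDr ?mule_ge0 ?lee_fin ?subr_ge0// !muleA -!EFinM -addeA.
rewrite -ge0_muleDl ?lee_fin ?mulr_ge0 ?subr_ge0//.
by congr (_ + (EFin _) * _)%E; ring.
Qed.

(** Identities between mixtures hold as set functions, not as bundled probabilities; this carries
    them over to the product measure. *)
Lemma eq_Rintegral_product (p q : probability T R) (f : T * T -> R) :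
  (p : set T -> \bar R) = q ->
  \int[(p \x p)%E]_z f z = \int[(q \x q)%E]_z f z.
Proof.
move=> pq; congr fine; apply: eq_measure_integral => S _ _.
by congr (product_measure1 _ _ S).
Qed.

End mixtures.

(** * Symmetry and scaling of the Ball divergence *)

Section ball_divergence_theory.
Context {R : realType} {A : completeNormedModType R}.
Implicit Types (a s t : R) (m n : probability (borelType A) R).

Lemma measurable_ball_through (u v : A) : measurable (ball_through u v).
Proof.
rewrite -[ball_through u v]setCK; apply: measurableC.
by apply: sub_sigma_algebra; exact/closed_openC/closed_closed_ball_.
Qed.

Lemma ball_div_ge0 a m n : 0 <= ball_div a m n.
Proof. by apply: Rintegral_ge0 => z _; rewrite sqr_ge0. Qed.

(** The exchange only flips the sign under the square, and [mixC] identifies the integrating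
    measures. *)
Lemma ball_divC a m n : 0 <= a <= 1 -> ball_div a m n = ball_div (1 - a) n m.
Proof.
move=> a01; rewrite /ball_div (eq_Rintegral_product _ (mixC m n a01)).
by apply: eq_Rintegral => z _; rewrite -sqrrN opprB.
Qed.

Lemma ball_div_mixl s t m n : 0 < s <= 1 -> 0 <= t <= 1 ->
  ball_div t (mix s m n) n = s ^+ 2 * ball_div (t * s) m n.
Proof.
move=> /andP[s0 s1] t01; have s01 : 0 <= s <= 1 by rewrite ltW.
rewrite /ball_div (eq_Rintegral_product _ (mix_mixl m n s01 t01)).
(* Nonnegativity of the squared difference is all that is established about the integrand as a
   function of [z]. *)
rewrite -[RHS]ge0_RintegralZl_gt0 ?exprn_gt0//; last first.
  by move=> z; rewrite sqr_ge0.
apply: eq_Rintegral => z _.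
have mB := measurable_ball_through z.1 z.2.
rewrite -exprMn/= mixE// -(fineK (fin_num_measure m _ mB)).
rewrite -(fineK (fin_num_measure n _ mB)) -!EFinM -EFinD/=; congr (_ ^+ 2).
by ring.
Qed.

(** Exchange the laws, apply [ball_div_mixl] at scale [1 - t], and exchange back. *)
Lemma ball_div_mixr s t m n : 0 < s <= 1 -> 0 <= t <= 1 ->
  ball_div t m (mix s n m) = s ^+ 2 * ball_div (1 - (1 - t) * s) m n.
Proof.
move=> /[dup] s01 /andP[s0 s1] /[dup] t01 /andP[t0 t1].
have t01' : 0 <= 1 - t <= 1 by rewrite subr_ge0 gerBl t0 t1.
have t1s01 : 0 <= (1 - t) * s <= 1.
  by case/andP: t01' => ? ?; rewrite mulr_ge0 ?mulr_ile1// ltW.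
by rewrite (ball_divC _ _ t01) (ball_div_mixl n m s01 t01') (ball_divC n m t1s01).
Qed.

End ball_divergence_theory.

(** * Bounds on [hfun] and on its weighted versions *)

Section hfun_theory.
Context {R : realType}.
Implicit Types a b : R.

Lemma hfun_after a b : a <= b -> hfun a b = a / b.
Proof. by move=> ab; rewrite /hfun ab ltNge ab mulr1 mulr0 addr0. Qed.

Lemma hfun_before a b : b < a -> hfun a b = (1 - a) / (1 - b).
Proof. by move=> ba; rewrite /hfun ba leNgt ba mulr1 mulr0 add0r. Qed.

Lemma hfun_diag a : a != 0 -> hfun a a = 1.
Proof. by move=> a0; rewrite hfun_after// divff. Qed.

(** In each branch the positive numerator is at most the denominator; hence [hfun] is a genuine
    mixing weight, maximal on the diagonal. *)
Lemma hfun_gt0_le1 a b : 0 < a < 1 -> 0 < b < 1 -> 0 < hfun a b <= 1.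
Proof.
move=> /andP[a0 a1] /andP[b0 b1]; have [ab|ba] := leP a b.
  by rewrite hfun_after// divr_gt0//= ler_pdivrMr// mul1r.
rewrite hfun_before// divr_gt0 ?subr_gt0//= ler_pdivrMr ?subr_gt0// mul1r.
by rewrite lerB// ltW.
Qed.

(** Strictness off the diagonal is what later makes the maximizer unique. *)
Lemma hfun_weight_lt a b : 0 < a < 1 -> 0 < b < 1 -> b != a ->
  b * (1 - b) * hfun a b < a * (1 - a).
Proof.
move=> /andP[a0 a1] /andP[b0 b1]; rewrite neq_lt => /orP[ba|ab].
  rewrite hfun_before// (_ : _ * _ = b * (1 - a)); first by nra.
  by field; rewrite subr_eq0 gt_eqF.
rewrite hfun_after ?ltW// (_ : _ * _ = a * (1 - b)); first by nra.
by field; rewrite gt_eqF.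
Qed.

(** Since [0 < hfun a b <= 1], squaring it can only decrease the weight. *)
Lemma hfun_sqr_weight_lt a b : 0 < a < 1 -> 0 < b < 1 -> b != a ->
  b * (1 - b) * hfun a b ^+ 2 < a * (1 - a).
Proof.
move=> a01 b01 ba; apply: le_lt_trans (hfun_weight_lt a01 b01 ba).
have /andP[h0 h1] := hfun_gt0_le1 a01 b01.
case/andP: b01 => b0 b1.
by rewrite expr2 mulrA ler_piMr// !mulr_ge0 ?subr_ge0// ltW.
Qed.

End hfun_theory.

(** * Time averages of the sequence in closed form *)

Section change_point_theory.
Context {d} {T : measurableType d} {R : realType}.
Implicit Types (a b : R) (m n : probability T R) (S : set T).

Lemma average_beforeE a b m n S : 0 < a < 1 -> 0 < b < 1 ->
  average_before a b m n S = before a b m n S.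
Proof.
move=> a01 /[dup] b01 /andP[b0 b1].
have /andP[h0 h1] := hfun_gt0_le1 a01 b01.
case/andP: a01 => a0 a1.
rewrite /average_before /before.
have [ab|ba] := leP a b.
  under eq_integral do rewrite /law_at (fun_if (fun p : probability T R => p S)).
  (* Before [b], law [m] lasts for time [a] and law [n] for time [b - a]. *)
  rewrite integral_itvoo_step ?(ltW a0)//= mixE ?h1 ?(ltW h0)//.
  rewrite ge0_muleDr ?mule_ge0 ?lee_fin ?subr_ge0 ?(ltW a0) ?invr_ge0 ?(ltW b0)// !muleA -!EFinM.
  rewrite hfun_after//.
  by congr (EFin _ * _ + EFin _ * _)%E; field; rewrite gt_eqF.
under eq_integral => t.
  rewrite inE/= in_itv/= => /andP[_ tb].
  rewrite /law_at (lt_trans tb ba).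
  over.
by rewrite integral_itvoo_cst ?ltW// subr0 muleA -EFinM mulVf ?gt_eqF// mul1e.
Qed.

Lemma average_afterE a b m n S : 0 < a < 1 -> 0 < b < 1 ->
  average_after a b m n S = after a b m n S.
Proof.
move=> a01 /[dup] b01 /andP[b0 b1].
have /andP[h0 h1] := hfun_gt0_le1 a01 b01.
case/andP: a01 => a0 a1.
rewrite /average_after /after.
have [ab|ba] := leP a b.
  under eq_integral => t.
    rewrite inE/= in_itv/= => /andP[bt _].
    rewrite /law_at ltNge (le_trans ab (ltW bt))/=.
    over.
  rewrite integral_itvoo_cst ?ltW// muleA -EFinM mulVf ?mul1e//.
  by rewrite subr_eq0 gt_eqF.
under eq_integral do rewrite /law_at (fun_if (fun p : probability T R => p S)).
rewrite integral_itvoo_step ?(ltW ba) ?(ltW a1)//= mixE ?h1 ?(ltW h0)//.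
rewrite ge0_muleDr ?mule_ge0 ?lee_fin ?invr_ge0 ?subr_ge0 ?(ltW ba) ?(ltW a1) ?(ltW b1)// !muleA -!EFinM.
(* [after] lists [n] first, whereas in time [m] comes first. *)
rewrite hfun_before// addeC.
by congr (EFin _ * _ + EFin _ * _)%E; field; rewrite subr_eq0 gt_eqF.
Qed.

End change_point_theory.

(** * The detection function and its maximizer *)

Section detection_theory.
Context {R : realType} {A : completeNormedModType R}.
Implicit Types (a b : R) (m n : probability (borelType A) R).

Lemma ball_div_before_after a b m n : 0 < a < 1 -> 0 < b < 1 ->
  ball_div b (before a b m n) (after a b m n) = hfun a b ^+ 2 * ball_div a m n.
Proof.
move=> a01 /[dup] b01 /andP[b0 b1]; have h01 := hfun_gt0_le1 a01 b01.
have b01' : 0 <= b <= 1 by rewrite !ltW.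
rewrite /before /after; have [ab|ba] := leP a b.
  (* [hfun] is exactly the weight that restores the scale [a] after mixing; on the other side this
     reads [(1 - b) * hfun a b = 1 - a]. *)
  have bh : b * hfun a b = a.
    by rewrite hfun_after// mulrC divfK// gt_eqF.
  by rewrite (ball_div_mixl m n h01 b01') bh.
have bh : 1 - (1 - b) * hfun a b = a.
  by rewrite hfun_before// mulrC divfK ?subKr// subr_eq0 gt_eqF.
by rewrite (ball_div_mixr m n h01 b01') bh.
Qed.

Lemma detectionE a b m n : 0 < a < 1 -> 0 < b < 1 ->
  detection a m n b = b * (1 - b) * hfun a b ^+ 2 * ball_div a m n.
Proof. by move=> a01 b01; rewrite /detection ball_div_before_after// mulrA. Qed.

Lemma detection_diag a m n : 0 < a < 1 ->
  detection a m n a = a * (1 - a) * ball_div a m n.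
Proof.
move=> a01; rewrite detectionE// hfun_diag ?expr1n ?mulr1//.
by case/andP: a01 => a0 _; rewrite gt_eqF.
Qed.

(** A nonzero divergence is positive, so the strict inequality between the weights survives
    multiplication by it. *)
Lemma detection_lt_max a b m n : 0 < a < 1 -> 0 < b < 1 -> b != a ->
  ball_div a m n != 0 -> detection a m n b < detection a m n a.
Proof.
move=> a01 b01 ba D0; rewrite detectionE// detection_diag// ltr_pM2r.
  exact: hfun_sqr_weight_lt.
by rewrite lt_def D0 ball_div_ge0.
Qed.

Lemma detection_le_max a b m n : 0 < a < 1 -> 0 < b < 1 ->
  detection a m n b <= detection a m n a.
Proof.
move=> a01 b01; have [->//|ba] := eqVneq b a.
rewrite detectionE// detection_diag// ler_wpM2r ?ball_div_ge0// ltW//.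
exact: hfun_sqr_weight_lt.
Qed.

End detection_theory.

Theorem mainTheorem1 (R : realType) (A : completeNormedModType R)
    (separableA : exists2 D : set A, countable D & dense D)
    (mu nu : probability (borelType A) R) (alpha : R)
    (alpha01 : 0 < alpha < 1) :
  (* a time after the change point *)
  (forall beta : R, alpha < beta < 1 ->
    [/\ forall S, measurable S ->
          average_before alpha beta mu nu S = mix (alpha / beta) mu nu S,
        forall S, measurable S -> average_after alpha beta mu nu S = nu S
      & ball_div beta (mix (alpha / beta) mu nu) nu =
          (alpha / beta) ^+ 2 * ball_div alpha mu nu]) /\
  (* an arbitrary time *)
  (forall beta : R, 0 < beta < 1 ->
    [/\ forall S, measurable S ->
          average_before alpha beta mu nu S = before alpha beta mu nu S,
        forall S, measurable S ->
          average_after alpha beta mu nu S = after alpha beta mu nu S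
      & ball_div beta (before alpha beta mu nu) (after alpha beta mu nu) =
          hfun alpha beta ^+ 2 * ball_div alpha mu nu]) /\
  (* the same identity, written out on each side of the change point *)
  (forall beta : R, alpha <= beta < 1 ->
    ball_div beta (mix (hfun alpha beta) mu nu) nu =
      hfun alpha beta ^+ 2 * ball_div alpha mu nu) /\
  (forall beta : R, 0 < beta < alpha ->
    ball_div beta mu (mix (hfun alpha beta) nu mu) =
      hfun alpha beta ^+ 2 * ball_div alpha mu nu) /\
  (forall beta : R, 0 < beta < 1 -> hfun alpha beta <= hfun alpha alpha) /\
  (forall beta : R, 0 < beta < 1 ->
    detection alpha mu nu beta =
      beta * (1 - beta) * hfun alpha beta ^+ 2 * ball_div alpha mu nu) /\
  (forall beta : R, 0 < beta < 1 ->
    beta * (1 - beta) * hfun alpha beta <=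
      alpha * (1 - alpha) * hfun alpha alpha) /\
  (forall beta : R, 0 < beta < 1 ->
    detection alpha mu nu beta <= detection alpha mu nu alpha) /\
  (* when the two laws are told apart, maximizing V returns alpha *)
  (ball_div alpha mu nu != 0 ->
    forall beta : R, 0 < beta < 1 ->
      (forall gamma : R, 0 < gamma < 1 ->
        detection alpha mu nu gamma <= detection alpha mu nu beta) ->
      beta = alpha).
Proof.
have /andP[a0 a1] := alpha01.
have after_lt1 b : alpha <= b < 1 -> 0 < b < 1.
  by move=> /andP[/(lt_le_trans a0) -> ->].
have before_lt1 b : 0 < b < alpha -> 0 < b < 1.
  by move=> /andP[-> /lt_trans ->].
have divergence_after b : alpha <= b < 1 ->
    ball_div b (mix (hfun alpha b) mu nu) nu =
      hfun alpha b ^+ 2 * ball_div alpha mu nu.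
  move=> /[dup] /after_lt1 b01 /andP[ab _].
  by have := ball_div_before_after mu nu alpha01 b01; rewrite /before /after ab.
split; [|split; [|split; [exact: divergence_after|split; [|split; [|split; [|
  split; [|split]]]]]]].
- move=> b /andP[ab b1]; have ab1 : alpha <= b < 1 by rewrite ltW.
  have b01 := after_lt1 b ab1.
  split=> [S mS|S mS|].
  + rewrite average_beforeE// /before (ltW ab)/=.
    by rewrite -(hfun_after (ltW ab)).
  + by rewrite average_afterE// /after (ltW ab).
  + by rewrite -(hfun_after (ltW ab)) divergence_after.
- move=> b b01; split=> [S mS|S mS|].
  + exact: average_beforeE.
  + exact: average_afterE.
  + exact: ball_div_before_after.
- move=> b /[dup] /before_lt1 b01 /andP[_ ba].
  have := ball_div_before_after mu nu alpha01 b01.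
  by rewrite /before /after leNgt ba.
- move=> b b01; rewrite hfun_diag ?gt_eqF//.
  by case/andP: (hfun_gt0_le1 alpha01 b01).
- by move=> b b01; rewrite detectionE.
- move=> b b01; have [->//|ba] := eqVneq b alpha.
  rewrite hfun_diag ?gt_eqF// mulr1 ltW//; exact: hfun_weight_lt.
- by move=> b b01; exact: detection_le_max.
(* A maximizer other than [alpha] would be strictly beaten at [alpha], against [maxb] taken
   there. *)
- move=> D0 b b01 maxb; apply: contrapT => /eqP ba.
  have := detection_lt_max alpha01 b01 ba D0.
  by rewrite ltNge maxb.
Qed.
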